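(* For any $A\subset\mathbb R^n$ there exists a $K_\sigma$-set $A_0\subset A$ (a countable union of compact sets) such that $\mu^A=\mu^{A_0}$ for all $\mu\in\mathfrak M^+$. Consequently $A^r=(A_0)^r$.
   Context: Standing assumptions: $n\ge3$, $\alpha\in(0,2]$, and $\kappa_\alpha(x,y)=|x-y|^{\alpha-n}$ is the Riesz kernel on $\mathbb R^n$. $\mathfrak M^+$ denotes the cone of positive Radon measures $\mu$ on $\mathbb R^n$ whose potential $\kappa_\alpha\mu(x)=\int|x-z|^{\alpha-n}d\mu(z)$ is not identically $+\infty$. The energy of $\mu$ is $\|\mu\|_\alpha^2=\iint\kappa_\alpha\,d\mu\,d\mu$; $\mathcal E^+_\alpha(A)$ is the set of positive measures of finite energy concentrated on $A$. The inner capacity of $A\subset\mathbb R^n$ is defined by $1/c_\alpha(A)=\inf\{\|\mu\|_\alpha^2:\ \mu\in\mathcal E^+_\alpha(A),\ \mu(\mathbb R^n)=1\}$. ''n.e. on $A$'' means: for all points of $A$ except a subset of inner capacity zero. Inner balayage: for $\mu\in\mathfrak M^+$ and arbitrary $A$, $\mu^A$ is the unique measure in $\mathfrak M^+$ with $\kappa_\alpha\mu^A=\inf\{\kappa_\alpha\nu:\ \nu\in\mathfrak M^+,\ \kappa_\alpha\nu\ge\kappa_\alpha\mu \text{ n.e. on }A\}$ pointwise. $\varepsilon_y$ is the Dirac measure at $y$, $\varepsilon_y^A:=(\varepsilon_y)^A$, $A^r:=\{y:\ \varepsilon_y^A=\varepsilon_y\}$. *)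

(* Defs.v *)
From HB Require Import structures.
From mathcomp Require Import all_boot all_order all_algebra.
From mathcomp Require Import all_classical all_reals all_analysis.
Set Implicit Arguments. Unset Strict Implicit. Unset Printing Implicit Defensive.
Import Order.TTheory GRing.Theory Num.Theory.
Import numFieldNormedType.Exports.
Local Open Scope classical_set_scope.
Local Open Scope ring_scope.

Section Riesz.
Variables (R : realType) (n : nat) (alpha : R).

(* R^n as row vectors, with its usual (product = Euclidean) topology *)
Local Notation Rn := 'rV[R]_n.

Definition BRn : measurableType (@open Rn).-sigma := g_sigma_algebraType (@open Rn).

Definition enorm (x : Rn) : R := Num.sqrt (\sum_(i < n) (x ord0 i) ^+ 2).

Definition rkernel (x y : Rn) : \bar R :=
  if x == y then +oo%E else ((enorm (x - y)) `^ (alpha - n%:R))%:E.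

Definition meas := {measure set BRn -> \bar R}.

Definition pot (mu : meas) (x : Rn) : \bar R :=
  (\int[mu]_(z in setT) rkernel x z)%E.

Definition energy (mu : meas) : \bar R :=
  (\int[mu]_(x in setT) pot mu x)%E.

(* Radon (= locally finite Borel) positive measure on R^n *)
Definition radon (mu : meas) : Prop :=
  forall K : set Rn, compact K -> (mu K < +oo)%E.

Definition Mplus (mu : meas) : Prop :=
  radon mu /\ exists x : Rn, (pot mu x < +oo)%E.

Definition concentrated (mu : meas) (A : set Rn) : Prop :=
  mu.-negligible (~` A : set BRn).

Definition inv_inner_cap (A : set Rn) : \bar R :=
  ereal_inf [set e | exists mu : meas,
    [/\ radon mu, (energy mu < +oo)%E, concentrated mu A,
        mu setT = 1%E & e = energy mu]].

Definition cap_zero (A : set Rn) : Prop := inv_inner_cap A = +oo%E.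

Definition ne_on (A : set Rn) (P : Rn -> Prop) : Prop :=
  exists E : set Rn, [/\ E `<=` A, cap_zero E & forall x, A x -> ~ E x -> P x].

Definition is_balayage (mu : meas) (A : set Rn) (nu : meas) : Prop :=
  Mplus nu /\
  forall x : Rn, pot nu x =
    ereal_inf [set e | exists nu' : meas,
      [/\ Mplus nu', ne_on A (fun y => (pot mu y <= pot nu' y)%E) & e = pot nu' x]].

Definition regular_pt (A : set Rn) (y : Rn) : Prop :=
  is_balayage (@dirac _ BRn y R) A (@dirac _ BRn y R).

End Riesz.

(* Main.v *)
Require Import Defs.
From HB Require Import structures.
From mathcomp Require Import all_boot all_order all_algebra.
From mathcomp Require Import all_classical all_reals all_analysis.
From mathcomp Require Import measurable_realfun lra.
Set Implicit Arguments. Unset Strict Implicit. Unset Printing Implicit Defensive.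
Import Order.TTheory GRing.Theory Num.Theory.
Import numFieldNormedType.Exports.
Local Open Scope classical_set_scope.
Local Open Scope ring_scope.

(** It suffices to find a sigma-compact [A0] contained in [A] such that, for
    [mu], [nu] in [Mplus], [pot nu >= pot mu] n.e. on [A0] implies the same n.e.
    on [A]: the families defining the two balayages then coincide.

    Consider the finite measures [lam] carried by compact subsets of [A] whose
    potential is continuous and bounded by a multiple of the weight
    [(1 + |x|)^(alpha - n)], which is integrable against every element of
    [Mplus].  By separability there is a countable family of such measures whose
    potentials approximate all the others pointwise and in a dominated way; take
    for [A0] the union of the compact carriers of that family.  If
    [pot nu >= pot mu] n.e. on [A0], then [int pot nu dlam >= int pot mu dlam] on
    the countable family, and reciprocity [int pot mu dlam = int pot lam dmu]
    with dominated convergence extends this to every such [lam].  On the other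
    hand, if [pot nu < pot mu] held on a subset of [A] of positive inner
    capacity, an Egorov argument and a weak maximum principle would restrict a
    measure of finite energy on that set to a compact set on which its potential
    is continuous, contradicting the previous inequality. *)

(** * Euclidean norm and Borel sets *)

Section EuclideanNorm.
Context {R : realType} {n : nat}.
Implicit Types x y : 'rV[R]_n.

Lemma enorm_ge0 x : 0 <= enorm x.
Proof. exact: sqrtr_ge0. Qed.

(** The norm carried by row vectors is the sup norm, while the kernel uses the Euclidean one. This
    bound and [enorm_le_normr] allow topological arguments in the former and kernel estimates in the
    latter, at the cost of a factor [n]. *)
Lemma normr_le_enorm x : `|x| <= enorm x.
Proof.
rewrite [leLHS]mx_normrE; apply: bigmax_le; first exact: enorm_ge0.
case=> i j _ /=; rewrite ord1 -sqrtr_sqr /enorm ler_wsqrtr//.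
by rewrite (bigD1 j)//= lerDl sumr_ge0// => k _; exact: sqr_ge0.
Qed.

Lemma coord_le_normr x (i : 'I_n) : `|x ord0 i| <= `|x|.
Proof.
rewrite [leRHS]mx_normrE.
by apply/bigmax_geP; right; exists (ord0, i).
Qed.

Lemma enorm_le_normr x : enorm x <= n%:R * `|x|.
Proof.
have n2 : (n%:R : R) <= n%:R ^+ 2.
  by rewrite -natrX ler_nat; case: n => // m; rewrite leq_pmulr.
rewrite -(@ger0_norm _ (n%:R * `|x|)) ?mulr_ge0//.
rewrite -sqrtr_sqr /enorm ler_wsqrtr// exprMn.
apply: (@le_trans _ _ (n%:R * `|x| ^+ 2)); last by rewrite ler_wpM2r// sqr_ge0.
rewrite [X in _ <= X * _](_ : _ = \sum_(i < n) (1 : R)); last first.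
  by rewrite sumr_const card_ord.
rewrite mulr_suml ler_sum// => i _; rewrite mul1r -[leLHS]real_normK ?num_real//.
by rewrite lerXn2r ?nnegrE// coord_le_normr.
Qed.

Lemma enormN x : enorm (- x) = enorm x.
Proof.
by rewrite /enorm; congr Num.sqrt; apply: eq_bigr => i _; rewrite mxE sqrrN.
Qed.

Lemma enorm_eq0 x : (enorm x == 0) = (x == 0).
Proof.
apply/eqP/eqP => [x0|->].
  by apply/eqP; rewrite -normr_eq0 eq_le normr_ge0 -[X in _ <= X]x0 normr_le_enorm.
by rewrite /enorm big1 ?sqrtr0// => i _; rewrite mxE expr0n.
Qed.

Lemma enorm_continuous : continuous (@enorm R n).
Proof.
have cadd : continuous (fun p : R * R => p.1 + p.2) by exact: add_continuous.
move=> x; apply: continuous_comp; last exact: sqrt_continuous.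
move: x; apply: (continuous_big cadd) => i _ x.
apply: (@cvg_comp _ _ _ (fun y : 'rV[R]_n => y ord0 i) (fun t : R => t ^+ 2)).
  exact: coord_continuous.
exact: exprn_continuous.
Qed.

Lemma ler_powR_neg (a b q : R) : q <= 0 -> 0 < a -> a <= b -> b `^ q <= a `^ q.
Proof.
move=> q0 a0 ab; rewrite -(opprK q) !(powRN _ (- q)) lef_pV2 ?posrE ?powR_gt0//.
  by rewrite ge0_ler_powR ?nnegrE ?oppr_ge0// ltW// (lt_le_trans a0).
exact: lt_le_trans ab.
Qed.

End EuclideanNorm.

(** * Borel measurability on R^n *)

Section BorelRn.
Context {R : realType} {n : nat}.
Local Notation Rn := 'rV[R]_n.

Lemma open_measurableBRn (U : set Rn) : open U -> measurable (U : set (BRn R n)).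
Proof. by move=> oU; exact: sub_sigma_algebra. Qed.

Lemma closed_measurableBRn (U : set Rn) : closed U -> measurable (U : set (BRn R n)).
Proof.
by move=> cU; rewrite -[U]setCK; apply: measurableC; apply: open_measurableBRn; exact: closed_openC.
Qed.

Lemma rV_hausdorff : hausdorff_space Rn.
Proof. exact: norm_hausdorff. Qed.

Lemma compact_measurableBRn (U : set Rn) : compact U -> measurable (U : set (BRn R n)).
Proof. by move=> cU; apply: closed_measurableBRn; exact: (compact_closed rV_hausdorff). Qed.

Lemma continuous_measurableBRn (f : Rn -> R) : continuous f ->
  measurable_fun setT (f : BRn R n -> R).
Proof.
move=> /continuousP cf; apply: (measurability _ (RGenOpens.measurableE R)).
move=> _ [_ [a [b ->] <-]]; rewrite setTI; apply: open_measurableBRn.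
exact/cf/interval_open.
Qed.

Lemma measurable_enormB :
  measurable_fun setT (fun p : BRn R n * BRn R n => enorm (p.1 - p.2 : Rn)).
Proof.
apply: (@measurableT_comp _ _ _ _ _ _ (@Num.sqrt R)).
  by apply: continuous_measurable_fun; exact: sqrt_continuous.
apply: measurable_sum => i; apply: measurable_funX.
under eq_fun => p do rewrite !mxE.
by apply: measurable_funB; apply: (@measurableT_comp _ _ _ _ _ _ (fun x : BRn R n => (x : Rn) ord0 i)) => //;
  apply: continuous_measurableBRn; exact: coord_continuous.
Qed.

End BorelRn.

(** * The Riesz kernel and its truncations *)

Section Kernel.
Context {R : realType} {n : nat} (alpha : R).
Hypothesis n_gt0 : (0 < n)%N.
Hypothesis alpha_ltn : alpha < n%:R.
Local Notation Rn := 'rV[R]_n.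
Local Notation rk := (@rkernel R n alpha).
Implicit Types x y z : Rn.

Let p_le0 : alpha - n%:R <= 0. Proof. by rewrite subr_le0 ltW. Qed.

(** The singular part of the kernel; [trunc_kernel] is the bounded part. The latter is kept equal to
    [r^(alpha - n)] inside the ball, which makes it continuous; the two parts then add up to an
    upper bound of the kernel, not to the kernel itself. *)
Definition near_kernel (r : R) x y : \bar R :=
  if enorm (x - y) < r then rk x y else 0%E.

Definition trunc_kernel (r : R) x y : R :=
  (Num.max (enorm (x - y)) r) `^ (alpha - n%:R).

Lemma rkernel_enormE x y : rk x y =
  if enorm (x - y) == 0 then +oo%E else (enorm (x - y) `^ (alpha - n%:R))%:E.
Proof. by rewrite enorm_eq0 subr_eq0. Qed.

Lemma rkernel_ge0 x y : (0 <= rk x y)%E.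
Proof. by rewrite rkernel_enormE; case: ifP => // _; rewrite lee_fin powR_ge0. Qed.

Lemma rkernelC x y : rk x y = rk y x.
Proof. by rewrite !rkernel_enormE -opprB enormN. Qed.

Lemma near_kernel_ge0 r x y : (0 <= near_kernel r x y)%E.
Proof. by rewrite /near_kernel; case: ifP => // _; exact: rkernel_ge0. Qed.

Lemma near_kernel_le r x y : (near_kernel r x y <= rk x y)%E.
Proof. by rewrite /near_kernel; case: ifP => // _; exact: rkernel_ge0. Qed.

Lemma trunc_kernel_ge0 r x y : 0 <= trunc_kernel r x y.
Proof. exact: powR_ge0. Qed.

Lemma trunc_kernel_le_powR r x y : 0 < r -> trunc_kernel r x y <= r `^ (alpha - n%:R).
Proof.
by move=> r0; apply: ler_powR_neg => //; rewrite le_max lexx orbT.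
Qed.

Lemma trunc_kernel_le r x y : 0 < r -> ((trunc_kernel r x y)%:E <= rk x y)%E.
Proof.
move=> r0; rewrite rkernel_enormE; case: ifPn => [_|d0]; first by rewrite leey.
rewrite lee_fin; apply: ler_powR_neg => //.
- by rewrite lt_neqAle eq_sym d0 enorm_ge0.
- by rewrite le_max lexx.
Qed.

Lemma rkernel_le_split r x y : 0 < r ->
  (rk x y <= (trunc_kernel r x y)%:E + near_kernel r x y)%E.
Proof.
move=> r0; rewrite /near_kernel; case: ltP => xyr.
  by rewrite leeDr// lee_fin trunc_kernel_ge0.
rewrite adde0 rkernel_enormE gt_eqF; last exact: lt_le_trans xyr.
by rewrite /trunc_kernel max_l.
Qed.

Lemma trunc_kernel_continuous r y : 0 < r -> continuous (trunc_kernel r ^~ y).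
Proof.
move=> r0 x; rewrite /trunc_kernel.
have cB : {for x, continuous (fun x => enorm (x - y))}.
  apply: (@continuous_comp _ _ _ (fun x => x - y) (@enorm R n)).
    by apply: (@continuousB _ _ _ (fun x => x) (fun=> y)); [exact: cvg_id|exact: cst_continuous].
  exact: enorm_continuous.
have cM : {for x, continuous ((fun x => enorm (x - y)) \max (fun=> r))}.
  by apply: continuous_max => //; exact: cst_continuous.
have m0 : 0 < Num.max (enorm (x - y)) r by rewrite lt_max r0 orbT.
apply: (@continuous_comp _ _ _ _ (@powR R ^~ (alpha - n%:R)) x cM).
apply: differentiable_continuous; apply/derivable1_diffP.
by have [] := is_derive1_powR (alpha - n%:R) m0.
Qed.

Lemma measurable_rkernel :
  measurable_fun setT (fun q : BRn R n * BRn R n => rk q.1 q.2).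
Proof.
under eq_fun do rewrite rkernel_enormE.
apply: measurable_fun_ifT => //.
  apply: (measurable_fun_bool true).
  rewrite (_ : _ @^-1` _ = (fun q : BRn R n * BRn R n => enorm (q.1 - q.2 : Rn)) @^-1` [set 0]).
    by have := @measurable_enormB R n measurableT [set 0] (measurable_set1 0); rewrite setTI.
  by apply/seteqP; split => [q /eqP//|q /= ->]; rewrite eqxx.
apply/measurable_EFinP.
by apply: (@measurableT_comp _ _ _ _ _ _ (@powR R ^~ (alpha - n%:R))) => //; exact: measurable_enormB.
Qed.

Lemma measurable_near_kernel r :
  measurable_fun setT (fun q : BRn R n * BRn R n => near_kernel r q.1 q.2).
Proof.
apply: measurable_fun_ifT => //; last exact: measurable_rkernel.
by apply: measurable_fun_ltr => //; exact: measurable_enormB.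
Qed.

Lemma measurable_trunc_kernel r :
  measurable_fun setT (fun q : BRn R n * BRn R n => trunc_kernel r q.1 q.2).
Proof.
apply: (@measurableT_comp _ _ _ _ _ _ (@powR R ^~ (alpha - n%:R))) => //.
by apply: measurable_maxr => //; exact: measurable_enormB.
Qed.

Lemma enorm_compare y y' z : `|y' - z| <= 2 * `|y - z| ->
  enorm (y' - z) <= 2 * n%:R * enorm (y - z).
Proof.
move=> yz; apply: (le_trans (enorm_le_normr _)); rewrite -mulrA mulrCA.
rewrite ler_wpM2l//; apply: (le_trans yz).
by rewrite ler_wpM2l// normr_le_enorm.
Qed.

(** The exponent [alpha - n] is negative, so the distance bound with constant [2 n] becomes a kernel
    bound with constant [(2 n)^(n - alpha)]; if [y' = z] the right side is infinite. *)
Lemma rkernel_compare y y' z : `|y' - z| <= 2 * `|y - z| ->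
  (rk y z <= ((2 * n%:R) `^ (n%:R - alpha))%:E * rk y' z)%E.
Proof.
move=> /enorm_compare yz; rewrite !rkernel_enormE.
have n2 : 0 < 2 * n%:R :> R by rewrite mulr_gt0// ltr0n.
have [y'z0|y'z0] := eqVneq (enorm (y' - z)) 0.
  by rewrite gt0_muley ?leey// lte_fin powR_gt0.
have d'0 : 0 < enorm (y' - z) by rewrite lt_neqAle eq_sym y'z0 enorm_ge0.
have d0 : 0 < enorm (y - z).
  by rewrite -(pmulr_rgt0 _ n2); exact: lt_le_trans yz.
rewrite gt_eqF// -EFinM lee_fin -[n%:R - alpha]opprB powRN mulrC ler_pdivlMr ?powR_gt0//.
by rewrite mulrC -powRM ?(ltW n2) ?(ltW d0)//; apply: ler_powR_neg.
Qed.

Lemma near_kernel_compare r y y' z : `|y' - z| <= 2 * `|y - z| ->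
  (near_kernel r y z <=
   ((2 * n%:R) `^ (n%:R - alpha))%:E * near_kernel (2 * n%:R * r) y' z)%E.
Proof.
move=> yz; rewrite {1}/near_kernel; case: ifPn => [yr|_].
  have n2 : 0 < 2 * n%:R :> R by rewrite mulr_gt0// ltr0n.
  rewrite /near_kernel (le_lt_trans (enorm_compare yz)) ?ltr_pM2l//.
  exact: rkernel_compare.
by rewrite mule_ge0 ?near_kernel_ge0// lee_fin powR_ge0.
Qed.

End Kernel.

(** * Radon measures and their potentials *)

Section RadonMeasures.
Context {R : realType} {n : nat}.
Local Notation Rn := 'rV[R]_n.
Local Open Scope ereal_scope.
Implicit Types mu nu lam : meas R n.

Lemma closed_norm_le (r : R) : closed [set x : Rn | `|x| <= r]%R.
Proof.
rewrite (_ : [set x | _] = (fun x : Rn => `|x|%R) @^-1` [set t | t <= r]%R)//.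
by apply: closed_comp => [x _|]; [exact: norm_continuous|exact: closed_le].
Qed.

Lemma compact_norm_le (r : R) : compact [set x : Rn | `|x| <= r]%R.
Proof.
apply: bounded_closed_compact; last exact: closed_norm_le.
by exists r; split; [exact: num_real|move=> M rM x /= /le_trans -> //; exact: ltW].
Qed.

Lemma radon_sigma_finite mu : radon mu -> sigma_finite setT mu.
Proof.
move=> rmu; exists (fun k : nat => [set x : Rn | `|x| <= k%:R]%R).
  apply/seteqP; split => // x _; exists (Num.truncn `|x|).+1 => //=.
  exact/ltW/truncnS_gt.
move=> k; split; first by apply: compact_measurableBRn; exact: compact_norm_le.
by apply: rmu; exact: compact_norm_le.
Qed.

Lemma finite_radon mu : mu setT < +oo -> radon mu.
Proof.
move=> fmu K cK; apply: le_lt_trans fmu; apply: le_measure; rewrite ?inE//.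
exact: compact_measurableBRn.
Qed.

(** Tonelli's theorem applies to measures bundled with a sigma-finite structure. A Radon measure
    gets one from the exhaustion by balls, and the structure is packed locally. *)
Lemma measurable_integral_snd mu (k : BRn R n * BRn R n -> \bar R) : radon mu ->
  measurable_fun setT k -> (forall q, 0 <= k q) ->
  measurable_fun setT (fun x => \int[mu]_z k (x, z)).
Proof.
move=> rmu mk k0.
have smu := radon_sigma_finite rmu.
pose H := isSigmaFinite.Build _ _ _ _ smu.
pose S := isSFinite.Build _ _ _ _ (sfinite_measure_sigma_finite smu).
pose mu' : {sigma_finite_measure set (BRn R n) -> \bar R} :=
  HB.pack_for (SigmaFiniteMeasure.type (BRn R n) R) (Measure.sort mu) H S.
exact: (@measurable_fun_fubini_tonelli_F _ _ _ _ _ mu' k mk k0).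
Qed.

Lemma radon_tonelli mu nu (k : BRn R n * BRn R n -> \bar R) : radon mu -> radon nu ->
  measurable_fun setT k -> (forall q, 0 <= k q) ->
  \int[mu]_x \int[nu]_z k (x, z) = \int[nu]_z \int[mu]_x k (x, z).
Proof.
move=> rmu rnu mk k0.
have smu := radon_sigma_finite rmu.
pose H := isSigmaFinite.Build _ _ _ _ smu.
pose S := isSFinite.Build _ _ _ _ (sfinite_measure_sigma_finite smu).
pose mu' : {sigma_finite_measure set (BRn R n) -> \bar R} :=
  HB.pack_for (SigmaFiniteMeasure.type (BRn R n) R) (Measure.sort mu) H S.
have snu := radon_sigma_finite rnu.
pose H' := isSigmaFinite.Build _ _ _ _ snu.
pose S' := isSFinite.Build _ _ _ _ (sfinite_measure_sigma_finite snu).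
pose nu' : {sigma_finite_measure set (BRn R n) -> \bar R} :=
  HB.pack_for (SigmaFiniteMeasure.type (BRn R n) R) (Measure.sort nu) H' S'.
exact: (@fubini_tonelli _ _ _ _ _ mu' nu' k mk k0).
Qed.

Lemma ge0_integral_mrestr mu (D : set (BRn R n)) (mD : measurable D)
    (f : BRn R n -> \bar R) : measurable_fun setT f -> (forall x, 0 <= f x) ->
  \int[mrestr mu mD]_x f x = \int[mu]_(x in D) f x.
Proof.
move=> mf f0.
have D0 : mrestr mu mD (~` D) = 0 by rewrite /mrestr setICl measure0.
rewrite (ge0_negligible_integral (measurableC mD) measurableT mf _ D0)//.
rewrite setTD setCK; apply: eq_measure_integral => A mA AD.
by rewrite /= /mrestr setIidl.
Qed.

End RadonMeasures.

(** * Potentials, reciprocity and the integrable weight *)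

Section Potentials.
Context {R : realType} {n : nat} (alpha : R).
Hypothesis n_gt0 : (0 < n)%N.
Hypothesis alpha_ltn : alpha < n%:R.
Local Notation Rn := 'rV[R]_n.
Local Notation rk := (@rkernel R n alpha).
Local Notation pot := (pot alpha).
Implicit Types mu nu lam : meas R n.

(** It decays at infinity like the kernel with one variable fixed, but has no singularity. *)
Definition weight (x : Rn) : R := (1 + `|x|) `^ (alpha - n%:R).

Let p_le0 : alpha - n%:R <= 0. Proof. by rewrite subr_le0 ltW. Qed.

Lemma weight_gt0 x : 0 < weight x.
Proof. by rewrite powR_gt0// ltr_pwDl. Qed.

Local Open Scope ereal_scope.

Lemma pot_ge0 mu x : 0 <= pot mu x.
Proof. by apply: integral_ge0 => z _; exact: rkernel_ge0. Qed.

Lemma measurable_rkernel_section (x : Rn) :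
  measurable_fun setT (fun z : BRn R n => rk x z).
Proof.
apply: (@measurableT_comp _ _ _ _ _ _ (fun q : BRn R n * BRn R n => rk q.1 q.2) _
  (fun z : BRn R n => (x : BRn R n, z))).
  exact: measurable_rkernel.
exact: pair1_measurable.
Qed.

Lemma measurable_pot mu : radon mu -> measurable_fun setT (pot mu : BRn R n -> \bar R).
Proof.
move=> rmu; apply: (@measurable_integral_snd _ _ _ (fun q => rk q.1 q.2)) => //.
  exact: measurable_rkernel.
by move=> q; exact: rkernel_ge0.
Qed.

Lemma pot_reciprocity mu nu : radon mu -> radon nu ->
  \int[mu]_x pot nu x = \int[nu]_x pot mu x.
Proof.
move=> rmu rnu.
rewrite (radon_tonelli rmu rnu (@measurable_rkernel R n alpha))/=; last first.
  by move=> q; exact: rkernel_ge0.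
by apply: eq_integral => z _; apply: eq_integral => x _; exact: rkernelC.
Qed.

Lemma measurable_weight : measurable_fun setT (weight : BRn R n -> R).
Proof.
apply: (@measurableT_comp _ _ _ _ _ _ (@powR R ^~ (alpha - n%:R)%R)) => //.
apply: measurable_funD => //; apply: continuous_measurableBRn.
exact: norm_continuous.
Qed.

(** The Euclidean distance from [x0] to [x] is at most [n (|x0| + |x|)], hence at most
    [n (1 + |x0|) (1 + |x|)]. *)
Lemma weight_le_rkernel x x0 :
  (weight x)%:E <= ((n%:R * (1 + `|x0|)) `^ (n%:R - alpha))%R%:E * rk x0 x.
Proof.
have c0 : (0 < n%:R * (1 + `|x0|) :> R)%R by rewrite mulr_gt0 ?ltr0n// ltr_pwDl.
rewrite rkernel_enormE; case: ifPn => [_|d0].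
  by rewrite gt0_muley ?leey// lte_fin powR_gt0.
rewrite -EFinM lee_fin -[(n%:R - alpha)%R]opprB powRN mulrC ler_pdivlMr ?powR_gt0//.
rewrite mulrC -powRM ?(ltW c0) ?addr_ge0//; apply: ler_powR_neg => //.
  by rewrite lt_neqAle eq_sym d0 enorm_ge0.
apply: (le_trans (enorm_le_normr _)); rewrite -mulrA ler_wpM2l//.
apply: (le_trans (ler_normB _ _)); rewrite mulrDr mulr1 mulrDl mul1r.
by have := normr_ge0 x; have := normr_ge0 x0; nra.
Qed.

(** The previous bound is integrated with [x0] a point where the potential of [mu] is finite. *)
Lemma Mplus_weight mu : Mplus alpha mu -> \int[mu]_x (weight x)%:E < +oo.
Proof.
move=> [rmu [x0 x0y]].
have C0 := powR_ge0 (n%:R * (1 + `|x0|))%R (n%:R - alpha)%R.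
apply: (@le_lt_trans _ _
    (((n%:R * (1 + `|x0|)) `^ (n%:R - alpha))%R%:E * pot mu x0)).
  rewrite /Defs.pot -ge0_integralZl//; last 2 first.
  - exact: measurable_rkernel_section.
  - by move=> z _; exact: rkernel_ge0.
  - apply: ge0_le_integral => //.
    + by move=> x _; rewrite lee_fin ltW// weight_gt0.
    + by apply/measurable_EFinP; exact: measurable_weight.
    + by apply: measurable_funeM; exact: measurable_rkernel_section.
    + by move=> x _; exact: weight_le_rkernel.
by rewrite lte_mul_pinfty// ?lee_fin.
Qed.

End Potentials.

(** * Inner regularity of finite Borel measures *)

Section InnerRegularity.
Context {R : realType} {n : nat} (lam : meas R n).
Hypothesis lam_fin : (lam setT < +oo)%E.
Local Notation Rn := 'rV[R]_n.
Local Open Scope ereal_scope.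

Lemma finite_measure_lty (A : set (BRn R n)) : measurable A -> lam A < +oo.
Proof. by move=> mA; apply: le_lt_trans lam_fin; apply: le_measure; rewrite ?inE. Qed.

Lemma nonincreasing_measure_lt (D : (set (BRn R n))^nat) (e : \bar R) :
  (forall k, measurable (D k)) -> nonincreasing_seq D ->
  lam (\bigcap_k D k) < e -> exists k, lam (D k) < e.
Proof.
move=> mD nD; apply: contraPP => /forallNP De; apply/negP; rewrite -leNgt.
have Dcvg : lam \o D @ \oo --> lam (\bigcap_k D k).
  apply: nonincreasing_cvg_mu => //; first exact: finite_measure_lty.
  exact: bigcap_measurable.
rewrite -(cvg_lim _ Dcvg)//; apply: lime_ge; first by apply/cvg_ex; eexists; exact: Dcvg.
by apply: nearW => k; rewrite leNgt; apply/negP/De.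
Qed.

Let closed_approx (A : set Rn) := forall e : R, (0 < e)%R ->
  exists F : set Rn, [/\ closed F, F `<=` A & lam (A `\` F) < e%:E].

Let open_approx (A : set Rn) := forall e : R, (0 < e)%R ->
  exists U : set Rn, [/\ open U, A `<=` U & lam (U `\` A) < e%:E].

Lemma open_closed_approx (U : set Rn) : open U -> closed_approx U.
Proof.
move=> oO e e0.
(* The points at distance at least [1/(k+1)] from the complement of [U]; these closed sets increase
   to [U] because [U] is open. *)
pose F (k : nat) := \bigcap_(y in ~` U) [set x : Rn | k.+1%:R^-1 <= `|x - y|]%R.
have cF k : closed (F k).
  apply: closed_bigI => y _.
  rewrite (_ : [set x | _] = (fun x : Rn => `|x - y|%R) @^-1` [set t | k.+1%:R^-1 <= t]%R)//.
  apply: closed_comp; last exact: closed_ge.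
  move=> x _; apply: (@continuous_comp _ _ _ (fun x : Rn => x - y)%R (fun x : Rn => `|x|%R)).
    by apply: (@continuousB _ _ _ (fun x => x) (fun=> y)); [exact: cvg_id|exact: cst_continuous].
  exact: norm_continuous.
have FO k : F k `<=` U.
  move=> x Fx; apply: contrapT => /Fx/=; rewrite subrr normr0.
  by rewrite leNgt invr_gt0 ltr0Sn.
have [k Fk] : exists k, lam (U `\` F k) < e%:E.
  apply: (@nonincreasing_measure_lt (fun k => U `\` F k)).
  - by move=> k; apply: measurableD; [exact: open_measurableBRn|exact: closed_measurableBRn].
  - apply/nonincreasing_seqP => k; apply/subsetPset; apply: setDS => x Fx y Oy.
    by apply: le_trans (Fx y Oy); rewrite /= lef_pV2 ?posrE ?ltr0Sn// ler_nat.
  - rewrite (_ : \bigcap_k _ = set0) ?measure0 ?lte_fin//.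
    apply/seteqP; split=> // x /= OFx.
    have [Ox _] := OFx 0%N I.
    have /nbhs_ballP[r /= r0 rO] : nbhs x U by exact: open_nbhs_nbhs.
    have [k _ /(_ _ (leqnn k)) /= kr] := near_infty_natSinv_lt (PosNum r0).
    have [_] := OFx k I; apply => y Oy /=; rewrite leNgt; apply/negP => xy.
    by apply: Oy; apply: rO; rewrite -ball_normE /=; exact: lt_trans kr.
by exists (F k).
Qed.

(** The sets approximable both from inside and from outside form a sigma-algebra containing the open
    sets. Both properties are treated together because complementation exchanges them. *)
Lemma borel_closed_open_approx (B : set Rn) : measurable (B : set (BRn R n)) ->
  closed_approx B /\ open_approx B.
Proof.
pose G : set (set Rn) := [set A | [/\ measurable (A : set (BRn R n)), closed_approx A & open_approx A]].
suff sG : <<s (@open Rn) >> `<=` G by move=> /sG[].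
apply: smallest_sub; last first.
  move=> U oO; split; first exact: open_measurableBRn.
    exact: open_closed_approx.
  by move=> e e0; exists U; split; rewrite ?setDv ?measure0 ?lte_fin.
split.
- split=> // e e0; exists set0; split; rewrite ?setDv ?measure0 ?lte_fin//.
    exact: closed0.
- move=> A [mA cA oA]; split; first exact: measurableD.
  + move=> e /oA [U [oO AO Oe]]; exists (~` U); split.
    * exact: open_closedC.
    * by rewrite setTD; exact: subsetC.
    * by rewrite setTD setDE setCK setIC -setDE.
  + move=> e /cA [F [cF FA Fe]]; exists (~` F); split.
    * exact: closed_openC.
    * by rewrite setTD; exact: subsetC.
    * by rewrite setTD setDE setCK setIC -setDE.
- move=> A GA.
  have mA k : measurable (A k : set (BRn R n)) by have [] := GA k.
  have mUA : measurable (\bigcup_k A k : set (BRn R n)) by exact: bigcupT_measurable.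
  split=> //.
  + move=> e e0.
    (* The tolerances add up to at most [e / 2], which keeps the final inequality strict. *)
    have ek k : (0 < e / 2 / (2 ^ k.+1)%:R)%R by rewrite !divr_gt0.
    have /choice[F Fk] : forall k, exists F : set Rn,
        [/\ closed F, F `<=` A k & lam (A k `\` F) < (e / 2 / (2 ^ k.+1)%:R)%:E].
      by move=> k; have [_ cA _] := GA k; exact: cA.
    have mF k : measurable (F k : set (BRn R n)).
      by have [? _ _] := Fk k; exact: closed_measurableBRn.
    (* An infinite union of closed sets may fail to be closed, so the union is cut to finitely many
       [F i]; continuity from above makes the extra loss small. *)
    have [k kF] : exists k, lam (\bigcup_k A k `\` \big[setU/set0]_(i < k) F i) < e%:E.
      apply: (@nonincreasing_measure_lt (fun k => \bigcup_k A k `\` \big[setU/set0]_(i < k) F i)).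
      * by move=> k; apply: measurableD => //; exact: bigsetU_measurable.
      * apply/nonincreasing_seqP => k; apply/subsetPset; apply: setDS.
        by rewrite big_ord_recr/=; exact: subsetUl.
      * apply: (@le_lt_trans _ _ (e / 2)%:E); last by rewrite lte_fin ltr_pdivrMr// ltr_pMr// ltr1n.
        apply: (@le_trans _ _ (\sum_(k <oo) lam (A k `\` F k))).
          apply: measure_sigma_subadditive => [k||].
          - exact: measurableD.
          - by apply: bigcapT_measurable => k; apply: measurableD => //; exact: bigsetU_measurable.
          - move=> x /= AFx; have [[k _ Akx] _] := AFx 0%N I; exists k => //; split => //.
            move=> Fkx; have [_] := AFx k.+1 I; apply.
            by rewrite big_ord_recr/=; right.
        apply: (le_trans _ (epsilon_trick0 xpredT _)); last by rewrite divr_ge0// ltW.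
        by apply: lee_nneseries => // k _; have [_ _ /ltW] := Fk k.
    exists (\big[setU/set0]_(i < k) F i); split => //.
      by apply: closed_bigsetU => i _; have [] := Fk i.
    by rewrite -bigcup_mkord => x [i /= _ Fix]; exists i => //; have [_ + _] := Fk i; apply.
  + move=> e e0.
    have e20 : (0 < e / 2)%R by rewrite divr_gt0.
    have ek k : (0 < e / 2 / (2 ^ k.+1)%:R)%R by rewrite !divr_gt0.
    have /choice[U Ok] : forall k, exists U : set Rn,
        [/\ open U, A k `<=` U & lam (U `\` A k) < (e / 2 / (2 ^ k.+1)%:R)%:E].
      by move=> k; have [_ _ oA] := GA k; exact: oA.
    have mO k : measurable (U k : set (BRn R n)).
      by have [? _ _] := Ok k; exact: open_measurableBRn.
    exists (\bigcup_k U k); split.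
    * by apply: bigcup_open => k _; have [] := Ok k.
    * by move=> x [k _ Akx]; exists k => //; have [_ + _] := Ok k; apply.
    * apply: (@le_lt_trans _ _ (e / 2)%:E); last by rewrite lte_fin ltr_pdivrMr// ltr_pMr// ltr1n.
      apply: (@le_trans _ _ (\sum_(k <oo) lam (U k `\` A k))).
        apply: measure_sigma_subadditive => [k||].
        - exact: measurableD.
        - by apply: measurableD => //; exact: bigcupT_measurable.
        - by move=> x [[k _ Okx] nA]; exists k => //; split=> // Akx; apply: nA; exists k.
      apply: (le_trans _ (epsilon_trick0 xpredT _)); last exact: ltW.
      by apply: lee_nneseries => // k _; have [_ _ /ltW] := Ok k.
Qed.

(** A closed subset missing less than the full mass of [B] has positive mass, and so does its
    intersection with a large enough ball. *)
Lemma compact_inner_regular (B : set Rn) : measurable (B : set (BRn R n)) ->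
  0 < lam B -> exists K : set Rn, [/\ compact K, K `<=` B & 0 < lam K].
Proof.
move=> mB B0.
have fB : lam B \is a fin_num by rewrite ge0_fin_numE// finite_measure_lty.
have [cB _] := borel_closed_open_approx mB.
have [|F [cF FB Fe]] := cB (fine (lam B)).
  by rewrite fine_gt0// B0 finite_measure_lty.
have mF := closed_measurableBRn cF.
have F0 : 0 < lam F.
  rewrite lt0e measure_ge0 andbT; apply/eqP => F0.
  move: Fe; rewrite fineK// measureD ?setIidr ?finite_measure_lty//.
  by rewrite [X in _ - X]F0 sube0 ltxx.
have [k Fk] : exists k : nat, lam (F `\` [set x : Rn | `|x| <= k%:R]%R) < lam F.
  apply: (@nonincreasing_measure_lt (fun k : nat => F `\` [set x : Rn | `|x| <= k%:R]%R)).
  - by move=> k; apply: measurableD => //; apply: closed_measurableBRn; exact: closed_norm_le.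
  - apply/nonincreasing_seqP => k; apply/subsetPset; apply: setDS => x /= /le_trans; apply.
    by rewrite ler_nat.
  - rewrite (_ : \bigcap_k _ = set0) ?measure0//.
    apply/seteqP; split=> // x /= /(_ (Num.truncn `|x|).+1 I)[_]; apply => /=.
    exact/ltW/truncnS_gt.
exists (F `&` [set x | `|x| <= k%:R]%R); split.
- rewrite setIC; apply: compact_closedI => //; first exact: compact_norm_le.
- by move=> x [/FB].
- rewrite lt0e measure_ge0 andbT; apply/eqP => K0; move: Fk; apply/negP; rewrite -leNgt.
  have mk := closed_measurableBRn (@closed_norm_le R n k%:R).
  by rewrite [X in X <= _](measureDI lam mF mk) [X in _ + X]K0 adde0.
Qed.

End InnerRegularity.

(** * Potentials of the singular part of the kernel *)

(** Dominated convergence speaks of sequences; this turns its conclusion into continuity. *)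
Lemma sequential_continuous_at (R : realType) (V : normedModType R) (f : V -> R) (x : V) :
  (forall u : nat -> V, u @ \oo --> x -> f (u k) @[k --> \oo] --> f x) ->
  {for x, continuous f}.
Proof.
move=> fu; apply/cvgrPdist_lt => e e0; apply: contrapT => nfx.
have /choice[u ux] : forall k : nat, exists y, `|x - y| < k.+1%:R^-1 /\ e <= `|f x - f y|.
  move=> k; apply: contrapT => /forallNP nk; apply: nfx.
  have k0 : 0 < k.+1%:R^-1 :> R by rewrite invr_gt0 ltr0Sn.
  have := nbhsx_ballx x _ k0; apply: filterS => y.
  rewrite -ball_normE /= => xy; rewrite ltNge; apply/negP => ey.
  by apply: (nk y).
have : u @ \oo --> x.
  apply/cvgrPdist_lt => d d0.
  have [N _ Nd] := near_infty_natSinv_lt (PosNum d0).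
  exists N => // k /Nd /= kd; have [+ _] := ux k => /lt_trans; exact.
move=> /fu /cvgrPdist_lt/(_ e e0)[N _ /(_ N (leqnn N))] /=.
by have [_] := ux N; rewrite ltNge => ->.
Qed.

Section NearPotential.
Context {R : realType} {n : nat} (alpha : R).
Hypothesis n_gt0 : (0 < n)%N.
Hypothesis alpha_ltn : alpha < n%:R.
Local Notation Rn := 'rV[R]_n.
Local Notation rk := (@rkernel R n alpha).
Local Notation pot := (pot alpha).
Implicit Types mu nu lam : meas R n.
Local Open Scope ereal_scope.

Definition near_pot (r : R) lam (x : Rn) : \bar R :=
  \int[lam]_z near_kernel alpha r x z.

Lemma measurable_near_kernel_section (r : R) (x : Rn) :
  measurable_fun setT (fun z : BRn R n => near_kernel alpha r x z).
Proof.
apply: (@measurableT_comp _ _ _ _ _ _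
  (fun q : BRn R n * BRn R n => near_kernel alpha r q.1 q.2) _
  (fun z : BRn R n => (x : BRn R n, z))).
  exact: measurable_near_kernel.
exact: pair1_measurable.
Qed.

Lemma measurable_trunc_kernel_section (r : R) (x : Rn) :
  measurable_fun setT (fun z : BRn R n => trunc_kernel alpha r x z).
Proof.
apply: (@measurableT_comp _ _ _ _ _ _
  (fun q : BRn R n * BRn R n => trunc_kernel alpha r q.1 q.2) _
  (fun z : BRn R n => (x : BRn R n, z))).
  exact: measurable_trunc_kernel.
exact: pair1_measurable.
Qed.

Lemma measurable_near_pot (r : R) lam : radon lam ->
  measurable_fun setT (near_pot r lam : BRn R n -> \bar R).
Proof.
move=> rlam.
apply: (@measurable_integral_snd _ _ _ (fun q => near_kernel alpha r q.1 q.2)) => //.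
  exact: measurable_near_kernel.
by move=> q; exact: near_kernel_ge0.
Qed.

Lemma le_near_pot (r s : R) lam x : (r <= s)%R -> near_pot r lam x <= near_pot s lam x.
Proof.
move=> rs; apply: ge0_le_integral => //.
- by move=> z _; exact: near_kernel_ge0.
- exact: measurable_near_kernel_section.
- exact: measurable_near_kernel_section.
- move=> z _; rewrite /near_kernel; case: ifP => [xr|_]; first by rewrite (lt_le_trans xr).
  by case: ifP => // _; exact: rkernel_ge0.
Qed.

(** The kernel at [x] is integrable, hence finite for almost every [z], which forces [z] to differ
    from [x]. Then [near_kernel] vanishes at [z] for small radii, and the kernel itself
    dominates. *)
Lemma near_pot_cvg0 lam x : pot lam x < +oo ->
  near_pot k.+1%:R^-1 lam x @[k --> \oo] --> 0.
Proof.
move=> px.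
have mrk := measurable_rkernel_section alpha x.
have irk : lam.-integrable setT (fun z : BRn R n => rk x z).
  apply/integrableP; split => //; apply: le_lt_trans px.
  by rewrite le_eqVlt; apply/orP; left; apply/eqP; apply: eq_integral => z _;
    rewrite gee0_abs// rkernel_ge0.
have cvg0 : {ae lam, forall z : BRn R n, setT z ->
    (near_kernel alpha k.+1%:R^-1 x z @[k --> \oo] --> cst 0 z)}.
  have := integrable_ae measurableT irk; apply: filterS => z /(_ I) fz _.
  have xz : (0 < enorm (x - z))%R.
    rewrite lt_neqAle eq_sym enorm_ge0 andbT; apply/negP => xz.
    by move: fz; rewrite rkernel_enormE xz.
  have [N _ Nd] := near_infty_natSinv_lt (PosNum xz).
  apply: cvg_near_cst; exists N => // k /Nd /= kd.
  by rewrite /near_kernel ltNge ltW.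
have dom : {ae lam, forall (z : BRn R n) (k : nat), setT z ->
    `|near_kernel alpha k.+1%:R^-1 x z| <= rk x z}.
  by apply: aeW => z k _; rewrite gee0_abs ?near_kernel_ge0//; exact: near_kernel_le.
have [_ _] := dominated_convergence measurableT
  (fun k => measurable_near_kernel_section k.+1%:R^-1 x) (measurable_cst _) cvg0 irk dom.
by rewrite integral0.
Qed.

(* Weak maximum principle: compare [y] with a point [y'] of [K] nearest to [y], so that
   [|y' - z| <= 2 |y - z|] for [z] in [K]. *)
Lemma near_pot_maximum lam (K : set Rn) (r : R) (e : \bar R) : compact K -> K !=set0 ->
  lam (~` K) = 0 ->
  (forall y, K y -> near_pot (2 * n%:R * r) lam y <= e) ->
  forall y, near_pot r lam y <= ((2 * n%:R) `^ (n%:R - alpha))%R%:E * e.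
Proof.
move=> cK K0 lamK Ke y.
have cd : {within K, continuous (fun z : Rn => `|y - z|)}%R.
  apply: continuous_subspaceT => z.
  apply: (@continuous_comp _ _ _ (fun z : Rn => y - z)%R (fun x : Rn => `|x|%R)).
    by apply: (@continuousB _ _ _ (fun=> y) (fun x => x)); [exact: cst_continuous|exact: cvg_id].
  exact: norm_continuous.
have [y' /set_mem Ky' y'min] := compact_EVT_min K0 cK cd.
have C0 : (0 <= (2 * n%:R) `^ (n%:R - alpha))%R by exact: powR_ge0.
apply: (@le_trans _ _ (((2 * n%:R) `^ (n%:R - alpha))%R%:E * near_pot (2 * n%:R * r) lam y')).
  have mnk := measurable_near_kernel_section (2 * n%:R * r) y'.
  rewrite /near_pot -ge0_integralZl//; last by move=> z _; exact: near_kernel_ge0.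
  apply: ae_ge0_le_integral; first exact: measurableT.
  - by move=> z _; exact: near_kernel_ge0.
  - exact: measurable_near_kernel_section.
  - by move=> z _; rewrite mule_ge0 ?near_kernel_ge0.
  - exact: measurable_funeM.
  - exists (~` K); split => //.
      by apply: measurableC; exact: compact_measurableBRn.
    move=> z /=; apply: contra_not => Kz _; apply: near_kernel_compare => //.
    have zy : (`|y - y'| <= `|y - z|)%R by apply: y'min; rewrite inE.
    rewrite -(subrKA y); apply: (le_trans (ler_normD _ _)).
    by rewrite distrC mulr2n mulrDl mul1r lerD2r.
by apply: lee_wpmul2l => //; exact: Ke.
Qed.

End NearPotential.

(** * Continuous potentials *)

Lemma dist_sandwich (R : realType) (a b c d e : R) :
  a <= b <= a + e / 3 -> c <= d <= c + e / 3 -> `|a - c| < e / 3 -> `|b - d| < e.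
Proof. by move=> /andP[ab ba] /andP[cd dc]; rewrite !ltr_norml => /andP[ac ca]; lra. Qed.

Section ContinuousPotentials.
Context {R : realType} {n : nat} (alpha : R).
Hypothesis n_gt0 : (0 < n)%N.
Hypothesis alpha_ltn : alpha < n%:R.
Local Notation Rn := 'rV[R]_n.
Local Notation rk := (@rkernel R n alpha).
Local Notation pot := (pot alpha).
Implicit Types mu nu lam : meas R n.
Local Open Scope ereal_scope.

Let p_le0 : (alpha - n%:R <= 0)%R. Proof. by rewrite subr_le0 ltW. Qed.

Definition trunc_pot (r : R) lam (x : Rn) : \bar R :=
  \int[lam]_z (trunc_kernel alpha r x z)%:E.

Lemma trunc_pot_ge0 r lam x : 0 <= trunc_pot r lam x.
Proof. by apply: integral_ge0 => z _; rewrite lee_fin trunc_kernel_ge0. Qed.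

Lemma trunc_pot_bounded r lam x : (0 < r)%R ->
  trunc_pot r lam x <= (r `^ (alpha - n%:R))%R%:E * lam setT.
Proof.
move=> r0; rewrite -integral_cst//; apply: ge0_le_integral => //.
- by move=> z _; rewrite lee_fin trunc_kernel_ge0.
- by apply/measurable_EFinP; exact: measurable_trunc_kernel_section.
- by move=> z _; rewrite lee_fin; exact: trunc_kernel_le_powR.
Qed.

Lemma trunc_pot_fin_num r lam x : (0 < r)%R -> lam setT < +oo ->
  trunc_pot r lam x \is a fin_num.
Proof.
move=> r0 lfin; rewrite ge0_fin_numE ?trunc_pot_ge0//.
apply: (le_lt_trans (trunc_pot_bounded lam x r0)).
by rewrite lte_mul_pinfty// lee_fin powR_ge0.
Qed.

Lemma trunc_pot_le r lam x : (0 < r)%R -> trunc_pot r lam x <= pot lam x.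
Proof.
move=> r0; apply: ge0_le_integral => //.
- by move=> z _; rewrite lee_fin trunc_kernel_ge0.
- by apply/measurable_EFinP; exact: measurable_trunc_kernel_section.
- exact: measurable_rkernel_section.
- by move=> z _; exact: trunc_kernel_le.
Qed.

Lemma pot_le_split r lam x : (0 < r)%R ->
  pot lam x <= trunc_pot r lam x + near_pot alpha r lam x.
Proof.
move=> r0; rewrite /trunc_pot /near_pot -ge0_integralD//.
- apply: ge0_le_integral => //.
  + by move=> z _; exact: rkernel_ge0.
  + exact: measurable_rkernel_section.
  + apply: emeasurable_funD; last exact: measurable_near_kernel_section.
    by apply/measurable_EFinP; exact: measurable_trunc_kernel_section.
  + by move=> z _; exact: rkernel_le_split.
- by move=> z _; rewrite lee_fin trunc_kernel_ge0.
- by apply/measurable_EFinP; exact: measurable_trunc_kernel_section.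
- by move=> z _; exact: near_kernel_ge0.
- exact: measurable_near_kernel_section.
Qed.

(** Dominated convergence: the bound [r^(alpha - n)] is integrable against a finite measure. *)
Lemma trunc_pot_continuous r lam : (0 < r)%R -> lam setT < +oo ->
  continuous (fun x => fine (trunc_pot r lam x)).
Proof.
move=> r0 lfin x; apply: sequential_continuous_at => u ux.
apply: fine_cvg; rewrite fineK ?trunc_pot_fin_num//.
have icst : lam.-integrable setT (cst (r `^ (alpha - n%:R))%R%:E : BRn R n -> \bar R).
  apply/integrableP; split => //.
  rewrite (eq_integral (cst (r `^ (alpha - n%:R))%R%:E)); last first.
    by move=> z _; rewrite gee0_abs ?lee_fin ?powR_ge0.
  by rewrite integral_cst// lte_mul_pinfty// lee_fin powR_ge0.
have cvgt : {ae lam, forall z : BRn R n, setT z ->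
    (trunc_kernel alpha r (u k) z)%:E @[k --> \oo] --> (trunc_kernel alpha r x z)%:E}.
  apply: aeW => z _; apply: cvg_EFin; first by apply: nearW.
  by apply: (@cvg_comp _ _ _ u (trunc_kernel alpha r ^~ z) _ _ _ ux); exact: trunc_kernel_continuous.
have dom : {ae lam, forall (z : BRn R n) (k : nat), setT z ->
    `|(trunc_kernel alpha r (u k) z)%:E| <= cst (r `^ (alpha - n%:R))%R%:E z}.
  apply: aeW => z k _; rewrite gee0_abs ?lee_fin ?trunc_kernel_ge0//.
  exact: trunc_kernel_le_powR.
have mt y : measurable_fun setT (fun z : BRn R n => (trunc_kernel alpha r y z)%:E).
  by apply/measurable_EFinP; exact: measurable_trunc_kernel_section.
by have [_ _] := dominated_convergence measurableT (fun k => mt (u k)) (mt x) cvgt icst dom.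
Qed.

(** The potential lies between the truncated potential and its sum with [near_pot], so it is a
    uniform limit of continuous functions. *)
Lemma pot_continuous lam : lam setT < +oo ->
  (forall e : R, (0 < e)%R ->
     exists2 r : R, (0 < r)%R & forall y, near_pot alpha r lam y <= e%:E) ->
  exists f : Rn -> R, [/\ continuous f, forall x, pot lam x = (f x)%:E &
    exists M : R, forall x, (f x <= M)%R].
Proof.
move=> lfin near0.
have pfin x : pot lam x \is a fin_num.
  rewrite ge0_fin_numE ?pot_ge0//; have [r r0 re] := near0 1%R ltr01.
  apply: (le_lt_trans (pot_le_split lam x r0)); apply: lte_add_pinfty.
    by rewrite ltey_eq trunc_pot_fin_num.
  exact: le_lt_trans (re x) (ltry _).
exists (fun x => fine (pot lam x)); split; last 2 first.
- by move=> x; rewrite fineK.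
- have [r r0 re] := near0 1%R ltr01.
  exists (fine ((r `^ (alpha - n%:R))%R%:E * lam setT) + 1)%R => x.
  rewrite -lee_fin fineK// EFinD fineK; last first.
    by rewrite fin_numM// ge0_fin_numE.
  apply: (le_trans (pot_le_split lam x r0)); apply: leeD => //.
  exact: trunc_pot_bounded.
move=> x; apply/(@cvgrPdist_lt _ _ _ _ (nbhs_filter x)) => e e0.
have e30 : (0 < e / 3)%R by rewrite divr_gt0.
have [r r0 re] := near0 _ e30.
have /(@cvgrPdist_lt _ _ _ _ (nbhs_filter x))/(_ _ e30) := @trunc_pot_continuous r lam r0 lfin x.
apply: (@filterS _ _ (nbhs_filter x)) => y /=.
have key z : (fine (trunc_pot r lam z) <= fine (pot lam z) <= fine (trunc_pot r lam z) + e / 3)%R.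
  have tf := trunc_pot_fin_num z r0 lfin.
  apply/andP; split; first by rewrite fine_le// trunc_pot_le.
  rewrite -lee_fin EFinD !fineK//; apply: (le_trans (pot_le_split lam z r0)).
  exact: leeD.
exact: (dist_sandwich (key x) (key y)).
Qed.

(** Near [K] the potential is bounded and the weight is bounded below; far away the distance to [K]
    is at least a multiple of [1 + |x|]. The constant is a natural number so that such bounds form a
    countable family of conditions. *)
Lemma pot_le_weight lam (K : set Rn) (M : R) : lam setT < +oo -> compact K ->
  lam (~` K) = 0 -> (forall x, pot lam x <= M%:E) ->
  exists C : nat, forall x, pot lam x <= (C%:R * weight alpha x)%:E.
Proof.
move=> lfin cK lamK potM.
have mK := compact_measurableBRn cK.
have [L' [_ KL0]] := compact_bounded cK.
pose L := (Num.max L' 0 + 1)%R.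
have L1 : (1 <= L)%R by rewrite lerDr le_max lexx orbT.
have KL z : K z -> (`|z| <= L)%R.
  by apply: KL0; rewrite /L ltr_pwDr// le_max lexx.
pose D := ((L + 2) `^ (n%:R - alpha))%R.
have D0 : (0 < D)%R by rewrite powR_gt0// ltr_wpDl//; lra.
have DE : D = (((L + 2) `^ (alpha - n%:R))^-1)%R by rewrite /D -powRN opprB.
have M0 : (0 <= M)%R by rewrite -lee_fin; apply: le_trans (potM 0%R); exact: pot_ge0.
have [C CM] : exists C : nat, (Num.max (M * D) (D * fine (lam setT)) <= C%:R)%R.
  exists (Num.truncn (Num.max (M * D) (D * fine (lam setT)))%R).+1.
  exact/ltW/truncnS_gt.
move: CM; rewrite ge_max => /andP[C1 C2].
exists C => x; have [xL|xL] := leP (`|x|)%R (L + 1)%R.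
  apply: (le_trans (potM x)); rewrite lee_fin.
  apply: (@le_trans _ _ (M * D * weight alpha x)%R); last by rewrite ler_wpM2r// ltW// weight_gt0.
  rewrite -mulrA ler_peMr// DE mulrC ler_pdivlMr ?powR_gt0//; last lra.
  rewrite mul1r; apply: ler_powR_neg => //. 
  lra.
apply: (@le_trans _ _ (\int[lam]_z (cst (D * weight alpha x)%:E) z)).
  apply: ae_ge0_le_integral; first exact: measurableT.
  - by move=> z _; exact: rkernel_ge0.
  - exact: measurable_rkernel_section.
  - by move=> z _; rewrite lee_fin mulr_ge0 ?ltW// weight_gt0.
  - exact: measurable_cst.
  - exists (~` K); split => //; first exact: measurableC.
    move=> z /=; apply: contra_not => Kz _.
    (* Since [|z| <= L], it is enough that [1 + |x| <= (|x| - L) (L + 2)], which holds with equality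
       at [|x| = L + 1]. *)
    have xz : ((1 + `|x|) / (L + 2) <= enorm (x - z))%R.
      apply: (le_trans _ (normr_le_enorm _)).
      apply: (@le_trans _ _ (`|x| - `|z|)%R); last exact: lerB_dist.
      rewrite ler_pdivrMr; last lra.
      by have := KL z Kz; have := normr_ge0 z; nra.
    have q0 : (0 < (1 + `|x|) / (L + 2))%R.
      by apply: divr_gt0; [rewrite ltr_pwDl|lra].
    rewrite rkernel_enormE gt_eqF; last exact: lt_le_trans xz.
    rewrite lee_fin; apply: (le_trans (ler_powR_neg p_le0 q0 xz)).
    have L0 : (0 <= L + 2)%R by lra.
    have x0 : (0 <= 1 + `|x|)%R by rewrite addr_ge0.
    rewrite DE /weight (powRM _ x0) ?invr_ge0//.
    by rewrite -(powR_inv1 L0) powRAC powR_inv1 ?powR_ge0// mulrC.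
rewrite (_ : integral _ _ _ = (D * weight alpha x)%:E * lam setT); last exact: integral_cst.
rewrite -[lam setT]fineK ?ge0_fin_numE// -EFinM lee_fin.
by rewrite mulrAC ler_wpM2r// ltW// weight_gt0.
Qed.

End ContinuousPotentials.

(** * Restriction to compact sets with continuous potential *)

Section LusinRestriction.
Context {R : realType} {n : nat} (alpha : R).
Hypothesis n_gt0 : (0 < n)%N.
Hypothesis alpha_ltn : alpha < n%:R.
Local Notation Rn := 'rV[R]_n.
Local Notation pot := (pot alpha).
Implicit Types mu nu lam : meas R n.
Local Open Scope ereal_scope.

(** Finite energy makes the potential finite almost everywhere, so [near_pot] tends to 0 there as
    the radius shrinks; Egorov's argument makes the convergence uniform on a compact set of positive
    mass. *)
Lemma near_pot_egorov lam (B : set Rn) : lam setT < +oo -> energy alpha lam < +oo ->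
  measurable (B : set (BRn R n)) -> 0 < lam B ->
  exists K : set Rn, [/\ compact K, K `<=` B, 0 < lam K &
    forall e : R, (0 < e)%R -> exists2 r : R, (0 < r)%R &
      forall y, K y -> near_pot alpha r lam y <= e%:E].
Proof.
move=> lfin efin mB B0.
have rlam := finite_radon lfin.
have mpot := measurable_pot alpha rlam.
have ipot : lam.-integrable setT (pot lam : BRn R n -> \bar R).
  apply/integrableP; split => //; apply: le_lt_trans efin.
  by rewrite le_eqVlt; apply/orP; left; apply/eqP; apply: eq_integral => z _;
    rewrite gee0_abs// pot_ge0.
have [N [mN N0 potN]] := integrable_ae measurableT ipot.
pose A : set (BRn R n) := B `\` N.
have mA : measurable A by exact: measurableD.
have A0 : 0 < lam A.
  have -> // : lam A = lam B.
  rewrite [RHS](measureDI lam mB mN) [X in _ + X](_ : _ = 0) ?adde0//.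
  by apply: (subset_measure0 _ _ _ N0) => //; exact: measurableI.
have Apot x : A x -> pot lam x < +oo.
  move=> [_ Nx]; rewrite -ge0_fin_numE ?pot_ge0//; apply: contrapT => fx.
  by apply: Nx; apply: potN => /= /(_ I).
have fA : lam A \is a fin_num by rewrite ge0_fin_numE// finite_measure_lty.
pose E j k : set (BRn R n) :=
  A `&` [set x | j.+1%:R^-1%:E <= near_pot alpha k.+1%:R^-1 lam x].
have mE j k : measurable (E j k).
  by apply: emeasurable_fun_c_infty => //; apply: measurable_funTS; exact: measurable_near_pot.
(* The exceptional sets [E j (k j)] have total mass at most [e], half the mass of [A], so their
   complement in [A] keeps positive mass. *)
pose e : R := (fine (lam A) / 2)%R.
have e0 : (0 < e)%R by rewrite divr_gt0// fine_gt0// A0 finite_measure_lty.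
have /choice[k kE] : forall j, exists k, lam (E j k) < (e / (2 ^ j.+1)%:R)%:E.
  move=> j; apply: (@nonincreasing_measure_lt _ _ lam lfin (E j)) => //.
    apply/nonincreasing_seqP => k; apply/subsetPset; apply: setIS => x /= /le_trans; apply.
    by apply: le_near_pot; rewrite lef_pV2 ?posrE ?ltr0Sn// ler_nat.
  rewrite (_ : \bigcap_k _ = set0) ?measure0 ?lte_fin ?(divr_gt0 e0)//.
  apply/seteqP; split => // x /= Ex; have [Ax _] := Ex 0%N I.
  have cvg0 := near_pot_cvg0 (Apot x Ax).
  have : j.+1%:R^-1%:E <= limn (fun k => near_pot alpha k.+1%:R^-1 lam x).
    apply: lime_ge; first by apply/cvg_ex; eexists; exact: cvg0.
    by apply: nearW => k; have [] := Ex k I.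
  rewrite (cvg_lim _ cvg0)// lee_fin leNgt invr_gt0.
  by rewrite ltr0Sn.
pose Bad := \bigcup_j E j (k j).
have mBad : measurable Bad by exact: bigcupT_measurable.
have Bad_lt : lam Bad < lam A.
  apply: (@le_lt_trans _ _ e%:E); last first.
    by rewrite -(fineK fA) lte_fin ltr_pdivrMr// ltr_pMr ?ltr1n// fine_gt0// A0 finite_measure_lty.
  apply: (@le_trans _ _ (\sum_(j <oo) lam (E j (k j)))).
    exact: measure_sigma_subadditive.
  apply: (le_trans _ (epsilon_trick0 xpredT _)); last exact: ltW.
  by apply: lee_nneseries => // j _; exact/ltW.
have [K [cK KA K0]] : exists K : set Rn, [/\ compact K, K `<=` A `\` Bad & 0 < lam K].
  apply: compact_inner_regular => //; first exact: measurableD.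
  rewrite lt0e measure_ge0 andbT; apply/eqP => AB0.
  move: Bad_lt; apply/negP; rewrite -leNgt.
  rewrite (measureDI lam mA mBad) [X in X + _]AB0 add0e.
  by apply: le_measure; rewrite ?inE//; exact: measurableI.
exists K; split => //; first by move=> x /KA[[]].
move=> d d0; have [j _ /(_ j (leqnn j)) /= jd] := near_infty_natSinv_lt (PosNum d0).
exists (k j).+1%:R^-1%R => [|y Ky]; first by rewrite invr_gt0.
have [Ay nBad] := KA y Ky.
apply: (@le_trans _ _ j.+1%:R^-1%:E); last by rewrite lee_fin ltW.
by rewrite leNgt; apply/negP => /ltW jy; apply: nBad; exists j.
Qed.

(** Restricting [lam] to [K] only lowers [near_pot], and the maximum principle carries its uniform
    smallness from [K] to the whole space. This costs a factor [2 n] in the radius and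
    [(2 n)^(n - alpha)] in the tolerance. *)
Lemma continuous_potential_restriction lam (B : set Rn) :
  lam setT < +oo -> energy alpha lam < +oo ->
  measurable (B : set (BRn R n)) -> 0 < lam B ->
  exists (K : set Rn) (cK : compact K) (f : Rn -> R) (C : nat),
    let lamK : meas R n := mrestr lam (compact_measurableBRn cK) in
    [/\ K `<=` B, 0 < lam K, continuous f, forall x, pot lamK x = (f x)%:E &
        forall x, (f x <= C%:R * weight alpha x)%R].
Proof.
move=> lfin efin mB B0.
have [K [cK KB K0 Knear]] := near_pot_egorov lfin efin mB B0.
have mK := compact_measurableBRn cK.
pose lamK : meas R n := mrestr lam (compact_measurableBRn cK).
have lKfin : lamK setT < +oo by rewrite /lamK /= /mrestr setTI finite_measure_lty.
have lK0 : lamK (~` K) = 0 by rewrite /lamK /= /mrestr setICl measure0.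
have Kn0 : K !=set0.
  apply/set0P/negP => /eqP KE; move: K0.
  by rewrite KE measure0 ltxx.
have n2 : (0 < 2 * n%:R :> R)%R by rewrite mulr_gt0// ltr0n.
have Cp : (0 < (2 * n%:R) `^ (n%:R - alpha) :> R)%R by rewrite powR_gt0.
have [e e0|f [cf fpot [M fM]]] := @pot_continuous R n alpha alpha_ltn lamK lKfin.
  have [r r0 rK] := Knear _ (divr_gt0 e0 Cp).
  exists (r / (2 * n%:R))%R; first by rewrite divr_gt0.
  move=> y; rewrite (_ : e%:E =
    ((2 * n%:R) `^ (n%:R - alpha))%R%:E * (e / (2 * n%:R) `^ (n%:R - alpha))%R%:E); last first.
    by rewrite -EFinM mulrC divfK// gt_eqF.
  apply: (near_pot_maximum n_gt0 alpha_ltn cK Kn0 lK0) => z Kz.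
  rewrite mulrC divfK ?gt_eqF//; apply: le_trans (rK z Kz).
  rewrite /near_pot /lamK ge0_integral_mrestr; last 2 first.
  - exact: measurable_near_kernel_section.
  - by move=> x; exact: near_kernel_ge0.
  apply: ge0_subset_integral => //; first exact: measurable_near_kernel_section.
  by move=> x _; exact: near_kernel_ge0.
have [|C fC] := pot_le_weight alpha_ltn lKfin cK lK0 (M := M).
  by move=> x; rewrite fpot lee_fin.
exists K, cK, f, C; split => // x.
by rewrite -lee_fin -fpot.
Qed.

End LusinRestriction.

(** * Countable approximation and inner capacity *)

(** A form of separability: for each finite list of conditions one element of [T] satisfying all of
    them is chosen, if there is any. There are countably many lists, and [None] stands for the
    unsatisfiable ones. *)
Lemma countable_approximation (X : Type) (Q : countType) (sat : Q -> X -> Prop)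
    (T : set X) :
  exists D : nat -> option X, (forall k x, D k = Some x -> T x) /\
    forall t, T t -> exists s : nat -> X,
      (forall j, exists k, D k = Some (s j)) /\
      forall q, sat q t -> exists N, forall j, (N <= j)%N -> sat q (s j).
Proof.
have /choice[d dP] : forall l : seq Q, exists o : option X,
    (forall x, o = Some x -> T x /\ forall q, q \in l -> sat q x) /\
    (forall x, T x -> (forall q, q \in l -> sat q x) -> o <> None).
  move=> l; have [[x [Tx lx]]|nx] := pselect (exists x, T x /\ forall q, q \in l -> sat q x).
    by exists (Some x); split => // y [<-].
  by exists None; split => // x Tx lx; exfalso; apply: nx; exists x.
exists (fun k => if unpickle k is Some l then d l else None); split.
  by move=> k x; case: unpickle => // l /(dP l).1[].
move=> t Tt.
(* The conditions with code below [j] that [t] satisfies; [t] itself witnesses that the list is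
   satisfiable in [T]. *)
pose l j : seq Q := [seq q <- pmap unpickle (iota 0 j) | `[< sat q t >]].
have lt_sat j q : q \in l j -> sat q t by rewrite mem_filter => /andP[/asboolP].
have /choice[s sd] : forall j, exists x, d (l j) = Some x.
  move=> j; have := (dP (l j)).2 t Tt (@lt_sat j).
  by case: (d (l j)) => // x _; exists x.
exists s; split => [j|q qt].
  by exists (pickle (l j)); rewrite pickleK.
exists (pickle q).+1 => j qj; have [_] := (dP (l j)).1 _ (sd j); apply.
rewrite mem_filter; apply/andP; split; first exact/asboolP.
rewrite mem_pmap; apply/mapP; exists (pickle q); last by rewrite pickleK.
by rewrite mem_iota add0n.
Qed.

(** * Sets of inner capacity zero *)

Section Capacity.
Context {R : realType} {n : nat} (alpha : R).
Local Notation Rn := 'rV[R]_n.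
Local Notation pot := (pot alpha).
Implicit Types mu nu lam : meas R n.
Local Open Scope ereal_scope.

(** The infimum runs over finite energies only, so it is [+oo] exactly when no measure is
    admissible. *)
Lemma cap_zeroP (E : set Rn) : cap_zero alpha E <->
  forall lam, radon lam -> energy alpha lam < +oo -> concentrated lam E ->
    lam setT = 1 -> False.
Proof.
rewrite /cap_zero /inv_inner_cap; split => [/ereal_inf_pinfty Einf lam rlam elam clam l1|E0].
  have : energy alpha lam = +oo by apply: Einf; exists lam.
  by move=> ey; move: elam; rewrite ey ltxx.
apply/ereal_inf_pinfty => e [lam [rlam elam clam l1 eE]]; exfalso; exact: (E0 lam).
Qed.

Lemma cap_zeroS (E F : set Rn) : E `<=` F -> cap_zero alpha F -> cap_zero alpha E.
Proof.
move=> EF /cap_zeroP F0; apply/cap_zeroP => lam rlam elam clam.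
by apply: F0 => //; apply: negligibleS clam; exact: subsetC.
Qed.

Lemma ne_onS (A B : set Rn) (P : Rn -> Prop) : A `<=` B ->
  ne_on alpha B P -> ne_on alpha A P.
Proof.
move=> AB [E [EB E0 EP]]; exists (E `&` A); split => //.
- by apply: cap_zeroS E0.
- by move=> x Ax nE; apply: EP; [exact: AB|move=> Ex; apply: nE].
Qed.

(** Otherwise [lam] restricted to [B] and normalised to unit mass would be admissible for [E], its
    energy being at most that of [lam] divided by [(lam B)^2]. *)
Lemma cap_zero_null (E B : set Rn) lam : cap_zero alpha E -> lam setT < +oo ->
  energy alpha lam < +oo -> measurable (B : set (BRn R n)) -> B `<=` E -> lam B = 0.
Proof.
move=> /cap_zeroP E0 lfin efin mB BE; apply/eqP/negPn/negP => B0.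
have lB0 : 0 < lam B by rewrite lt0e B0 measure_ge0.
have fB : lam B \is a fin_num by rewrite ge0_fin_numE// finite_measure_lty.
have c0 : (0 <= (fine (lam B))^-1)%R by rewrite invr_ge0 fine_ge0.
pose c : {nonneg R} := NngNum c0.
pose lamB : meas R n := mrestr lam mB.
pose lam' : meas R n := mscale c lamB.
have l1 : lam' setT = 1.
  rewrite /lam' /lamB /= /mscale /= /mrestr setTI -[X in _ * X](fineK fB) -EFinM mulVf//.
  by rewrite gt_eqF// fine_gt0// lB0 finite_measure_lty.
have rlam' : radon lam' by apply: finite_radon; rewrite l1 ltry.
have int' (f : BRn R n -> \bar R) : measurable_fun setT f -> (forall x, 0 <= f x) ->
    \int[lam']_x f x <= (fine (lam B))^-1%:E * \int[lam]_x f x.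
  move=> mf f0; rewrite ge0_integral_mscale// lee_wpmul2l//.
  rewrite /lamB ge0_integral_mrestr//.
  exact: ge0_subset_integral.
have pot' x : pot lam' x <= (fine (lam B))^-1%:E * pot lam x.
  by apply: int'; [exact: measurable_rkernel_section|move=> z; exact: rkernel_ge0].
apply: (E0 lam') => //.
- have rlam := finite_radon lfin.
  apply: (@le_lt_trans _ _ ((fine (lam B))^-1%:E * ((fine (lam B))^-1%:E * energy alpha lam))).
    apply: (@le_trans _ _ ((fine (lam B))^-1%:E * \int[lam]_x pot lam' x)).
      by apply: int'; [exact: measurable_pot|move=> x; exact: pot_ge0].
    rewrite lee_wpmul2l// /energy -ge0_integralZl//; last 2 first.
    - exact: measurable_pot.
    - by move=> x _; exact: pot_ge0.
    apply: ge0_le_integral => //.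
    - by move=> x _; exact: pot_ge0.
    - exact: measurable_pot.
    - by apply: measurable_funeM; exact: measurable_pot.
  by rewrite lte_mul_pinfty// ?lee_fin// lte_mul_pinfty// lee_fin.
- exists (~` B); split; first exact: measurableC.
  + by rewrite /lam' /lamB /= /mscale /= /mrestr setICl measure0 mule0.
  + exact: subsetC.
Qed.

End Capacity.

(** * The sigma-compact core *)

Section TestMeasures.
Context {R : realType} {n : nat} (alpha : R).
Hypothesis n_gt0 : (0 < n)%N.
Hypothesis alpha_ltn : alpha < n%:R.
Local Notation Rn := 'rV[R]_n.
Local Notation pot := (pot alpha).
Implicit Types mu nu lam : meas R n.

Let p_le0 : alpha - n%:R <= 0. Proof. by rewrite subr_le0 ltW. Qed.

Local Notation box := ('rV[rat]_n * rat)%type.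

Definition in_box (b : box) (x : Rn) : Prop :=
  forall i, `|x ord0 i - ratr (b.1 ord0 i)| < ratr b.2.

Lemma in_box_neighborhood (x : Rn) (d : R) : 0 < d ->
  exists b : box, in_box b x /\ forall y, in_box b y -> `|x - y| < d.
Proof.
move=> d0; have d40 : 0 < d / 4 by rewrite divr_gt0.
have d4 : d / 4 < d / 2 by lra.
(* A half-side below [d / 2] and a centre within [d / 4] of [x] place the box within [3 d / 4] of
   [x]; the half-side exceeds [d / 4], so the box contains [x]. *)
have [r] := rat_in_itvoo d4; rewrite in_itv /= => /andP[r1 r2].
have /choice[c cx] : forall i : 'I_n, exists c : rat, `|x ord0 i - ratr c| < d / 4.
  move=> i; have [c] := @rat_in_itvoo R (x ord0 i - d / 4) (x ord0 i + d / 4) ltac:(lra).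
  by rewrite in_itv /= => /andP[c1 c2]; exists c; rewrite ltr_norml; apply/andP; split; lra.
exists (\row_i c i, r); split => [i /=|y yb]; first by rewrite mxE; exact: lt_trans (cx i) r1.
apply: (@le_lt_trans _ _ (3 * d / 4)); last by lra.
rewrite [leLHS]mx_normrE; apply: bigmax_le; first by rewrite divr_ge0 ?mulr_ge0 ?ltW.
case=> i j _ /=; rewrite ord1 !mxE.
have := cx j; have := yb j; rewrite /= mxE !ltr_norml ler_norml => /andP[? ?] /andP[? ?].
by apply/andP; split; lra.
Qed.

Local Open Scope ereal_scope.

Definition test_measure (A : set Rn) : set (meas R n) := [set lam : meas R n |
  [/\ lam setT < +oo,
      exists K : set Rn, [/\ compact K, K `<=` A & lam (~` K) = 0],
      (exists2 f : Rn -> R, continuous f & forall x, pot lam x = (f x)%:E) &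
      exists C : nat, forall x, pot lam x <= (C%:R * weight alpha x)%:E]].

(** The index type is countable. The first kind of condition provides domination, the second
    pointwise convergence of potentials. *)
Definition pot_constraint (q : nat + (box * (rat * rat))) lam : Prop :=
  match q with
  | inl C => forall x, pot lam x <= (C%:R * weight alpha x)%:E
  | inr (b, (u, v)) => forall x, in_box b x -> (ratr u)%:E < pot lam x < (ratr v)%:E
  end.

(** The weight is at most 1, so the potential is bounded by [C] and [lam] is finite. *)
Lemma test_measure_energy A lam : test_measure A lam -> energy alpha lam < +oo.
Proof.
move=> [lfin _ _ [C fC]].
apply: (@le_lt_trans _ _ (\int[lam]_x (cst C%:R%:E x))).
  apply: ge0_le_integral => //.
  - by move=> x _; exact: pot_ge0.
  - by apply: measurable_pot; exact: finite_radon.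
  - move=> x _; apply: (le_trans (fC x)); rewrite lee_fin ler_piMr//.
    apply: (@le_trans _ _ (1 `^ (alpha - n%:R))%R); last by rewrite powR1.
    by apply: ler_powR_neg => //; rewrite lerDl.
rewrite (_ : integral _ _ _ = C%:R%:E * lam setT); last exact: integral_cst.
by rewrite lte_mul_pinfty// lee_fin.
Qed.

(** By continuity the potential of [lam] stays between two rationals close to [f x] on a rational
    box around [x]; this is one of the conditions that [s j] eventually inherits. *)
Lemma constraint_cvg A lam (s : nat -> meas R n) : test_measure A lam ->
  (forall q, pot_constraint q lam ->
     exists N, forall j, (N <= j)%N -> pot_constraint q (s j)) ->
  forall x, pot (s j) x @[j --> \oo] --> pot lam x.
Proof.
move=> [_ _ [f cf fpot] _] sq x.
have key (e : R) : (0 < e)%R -> exists N, forall j, (N <= j)%N ->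
    (f x - e)%:E < pot (s j) x < (f x + e)%:E.
  move=> e0.
  have e2 : (f x - e < f x - e / 2)%R by lra.
  have e3 : (f x + e / 2 < f x + e)%R by lra.
  have [u] := rat_in_itvoo e2; rewrite in_itv /= => /andP[u1 u2].
  have [v] := rat_in_itvoo e3; rewrite in_itv /= => /andP[v1 v2].
  have e20 : (0 < e / 2)%R by rewrite divr_gt0.
  have /(@cvgrPdist_lt _ _ _ _ (nbhs_filter x))/(_ _ e20) : {for x, continuous f} by exact: cf.
  move=> /nbhs_ballP[d /= d0 dB].
  have [b [bx bd]] := in_box_neighborhood x d0.
  have [|N Nj] := sq (inr (b, (u, v))).
    move=> y yb; rewrite fpot !lte_fin.
    have : ball x d y by rewrite -ball_normE /=; exact: bd.
    move=> /dB /=; rewrite ltr_norml => /andP[? ?].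
    by apply/andP; split; lra.
  exists N => j /Nj /(_ x bx) /andP[us sv]; apply/andP; split.
    by apply: lt_trans us; rewrite lte_fin.
  by apply: (lt_trans sv); rewrite lte_fin.
(* Tolerance 1 already makes the potentials finite at [x] from rank [N1] on, so convergence can be
   checked in the reals. *)
have [N1 N1P] := key 1%R ltr01.
rewrite fpot; apply: cvg_EFin.
  exists N1 => // j /= /N1P /andP[a b]; rewrite fin_numE; apply/andP; split.
    by apply/eqP => pj; rewrite pj in a.
  by apply/eqP => pj; rewrite pj in b.
apply/cvgrPdist_lt => e e0; have [N NP] := key e e0.
exists (maxn N N1) => // j /=; rewrite geq_max => /andP[/NP + /N1P].
case: (pot (s j) x) => [r| |] => [/andP[]|/andP[_]|/andP[]]; last 2 first.
- by rewrite ltNge leey.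
- by rewrite ltNge leNye.
rewrite !lte_fin => ? ? _ /=.
by rewrite ltr_norml; apply/andP; split; lra.
Qed.

(** Reciprocity turns both sides into integrals against [mu], where the weight is an integrable
    dominating function. *)
Lemma integral_pot_cvg A lam (s : nat -> meas R n) mu : test_measure A lam ->
  (forall j, s j setT < +oo) ->
  (forall q, pot_constraint q lam ->
     exists N, forall j, (N <= j)%N -> pot_constraint q (s j)) ->
  Mplus alpha mu ->
  \int[lam]_x pot mu x < +oo /\
  \int[s j]_x pot mu x @[j --> \oo] --> \int[lam]_x pot mu x.
Proof.
move=> Tlam sfin sq Mmu; have cvgp := constraint_cvg Tlam sq.
have [lfin _ [f cf fpot] [C fC]] := Tlam.
have rmu := Mmu.1; have wmu := Mplus_weight n_gt0 alpha_ltn Mmu.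
(* The same constant [C] serves all [s j] from rank [N] on; hence the shift by [N] below. *)
have [N NC] := sq (inl C) fC.
have mw : measurable_fun setT (fun x : BRn R n => (C%:R * weight alpha x)%:E).
  by apply/measurable_EFinP; apply: measurable_funM => //; exact: measurable_weight.
have w0 (x : Rn) : (0 <= weight alpha x)%R by rewrite ltW// weight_gt0.
have iw : mu.-integrable setT (fun x : BRn R n => (C%:R * weight alpha x)%:E).
  apply/integrableP; split => //.
  rewrite (eq_integral (fun x : BRn R n => C%:R%:E * (weight alpha x)%:E)); last first.
    by move=> x _; rewrite gee0_abs ?lee_fin ?mulr_ge0// EFinM.
  rewrite ge0_integralZl//; last 2 first.
  - by apply/measurable_EFinP; exact: measurable_weight.
  - by move=> x _; rewrite lee_fin.
  by rewrite lte_mul_pinfty// lee_fin.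
have swap k : radon k -> \int[k]_x pot mu x = \int[mu]_x pot k x.
  by move=> rk; exact: pot_reciprocity.
have cvg1 : {ae mu, forall x : BRn R n, setT x ->
    pot (s (j + N)%N) x @[j --> \oo] --> pot lam x}.
  by apply: aeW => x _; have := cvgp x; rewrite -(cvg_shiftn N).
have dom : {ae mu, forall (x : BRn R n) (j : nat), setT x ->
    `|pot (s (j + N)%N) x| <= (C%:R * weight alpha x)%:E}.
  by apply: aeW => x j _; rewrite gee0_abs ?pot_ge0//; apply: NC; rewrite leq_addl.
have mp (k : meas R n) : (k setT < +oo) -> measurable_fun setT (pot k : BRn R n -> \bar R).
  by move=> kfin; apply: measurable_pot; exact: finite_radon.
have [il _ cvgI] := dominated_convergence measurableT
  (fun j => mp _ (sfin (j + N)%N)) (mp _ lfin) cvg1 iw dom.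
rewrite swap; last exact: finite_radon.
split.
  have /integrableP[_] := il; apply: le_lt_trans; rewrite le_eqVlt; apply/orP; left.
  by apply/eqP; apply: eq_integral => x _; rewrite gee0_abs// pot_ge0.
rewrite -(cvg_shiftn N).
rewrite (_ : (fun j => _) = (fun j => \int[mu]_x pot (s (j + N)%N) x))//.
by apply/funext => j; rewrite swap//; exact: finite_radon.
Qed.

Lemma sigma_compact_core (A : set Rn) : exists A0 : set Rn,
  [/\ A0 `<=` A,
      exists K : nat -> set Rn, (forall k, compact (K k)) /\ A0 = \bigcup_k K k &
      forall mu nu, Mplus alpha mu -> Mplus alpha nu ->
        ne_on alpha A0 (fun y => pot mu y <= pot nu y) ->
        forall lam, test_measure A lam ->
          \int[lam]_x pot mu x < +oo /\
          \int[lam]_x pot mu x <= \int[lam]_x pot nu x].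
Proof.
have [D [DT Dapprox]] := countable_approximation pot_constraint (test_measure A).
have /choice[K KP] : forall k, exists K : set Rn, [/\ compact K, K `<=` A &
    forall lam, D k = Some lam -> lam (~` K) = 0].
  move=> k; case Dk : (D k) => [lam|]; last by exists set0; split => //; exact: compact0.
  by have [_ [K [? ? ?] _ _]] := DT _ _ Dk; exists K; split => // _ [<-].
exists (\bigcup_k K k); split.
- by move=> x [k _]; have [_ + _] := KP k; apply.
- by exists K; split => // k; have [] := KP k.
move=> mu nu Mmu Mnu [E [EA0 E0 EP]] lam Tlam.
have [s [sD sq]] := Dapprox lam Tlam.
have sT j : test_measure A (s j) by have [k /DT] := sD j.
have sfin j : s j setT < +oo by have [] := sT j.
have [mufin mucvg] := integral_pot_cvg Tlam sfin sq Mmu.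
have [_ nucvg] := integral_pot_cvg Tlam sfin sq Mnu.
split => //.
rewrite -(cvg_lim (@ereal_hausdorff R) mucvg) -(cvg_lim (@ereal_hausdorff R) nucvg).
apply: lee_lim; [by apply/cvg_ex; eexists; exact: mucvg|by apply/cvg_ex; eexists; exact: nucvg|].
apply: nearW => j; have [k Dk] := sD j; have [cK KA sK] := KP k.
have mK := compact_measurableBRn cK.
have mmu := measurable_pot alpha Mmu.1; have mnu := measurable_pot alpha Mnu.1.
(* The exceptional set [E] may fail to be Borel; [B] is a Borel subset of it, and a measure of
   finite energy gives it mass 0. *)
pose B : set (BRn R n) := K k `&` [set x | pot nu x < pot mu x].
have mB : measurable B.
  by apply: measurable_lte => //; exact: measurable_funTS.
have B0 : s j B = 0.
  apply: (cap_zero_null E0 (sfin j) (test_measure_energy (sT j)) mB) => x [Kx] /= nm.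
  apply: contrapT => nEx; have := EP x; rewrite leNgt nm => H.
  by apply: notF; apply: H => //; exists k.
apply: ae_ge0_le_integral; first exact: measurableT.
- by move=> x _; exact: pot_ge0.
- exact: mmu.
- by move=> x _; exact: pot_ge0.
- exact: mnu.
exists (~` K k `|` B); split.
- by apply: measurableU => //; exact: measurableC.
- by rewrite measureU0 ?sK//; exact: measurableC.
- move=> x /= /not_implyP[_ /negP]; rewrite -ltNge => nm.
  by have [Kx|Kx] := pselect (K k x); [right|left].
Qed.

Lemma ne_on_sigma_compact_core (A : set Rn) : exists A0 : set Rn,
  [/\ A0 `<=` A,
      exists K : nat -> set Rn, (forall k, compact (K k)) /\ A0 = \bigcup_k K k &
      forall mu nu, Mplus alpha mu -> Mplus alpha nu ->
        ne_on alpha A0 (fun y => pot mu y <= pot nu y) <->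
        ne_on alpha A (fun y => pot mu y <= pot nu y)].
Proof.
have [A0 [A0A A0K A0P]] := sigma_compact_core A.
exists A0; split => // mu nu Mmu Mnu; split; last exact: ne_onS.
move=> /(A0P mu nu Mmu Mnu) intP.
(* The whole failure set is taken as exceptional set; a unit measure of finite energy concentrated
   on it will give a contradiction. *)
exists [set x | A x /\ pot nu x < pot mu x]; split => [x []//||]; last first.
  by move=> x Ax nx; rewrite leNgt; apply/negP => nm; apply: nx.
apply/cap_zeroP => lam rlam elam [N [mN N0 EN]] l1.
have lfin : lam setT < +oo by rewrite l1 ltry.
have mB : measurable (~` N) by exact: measurableC.
(* The failure set need not be Borel, but the complement of [N] is a Borel subset of it of full
   mass. *)
have BE : ~` N `<=` [set x | A x /\ pot nu x < pot mu x].
  by rewrite -[X in _ `<=` X]setCK; exact: subsetC.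
have lB : 0 < lam (~` N).
  rewrite -[X in lam X]setTD measureD ?lfin// setTI [X in _ - X]N0 sube0 [X in _ < X]l1.
  exact: lte01.
have [K [cK [f [C [KB lK cf fpot fC]]]]] :=
  continuous_potential_restriction n_gt0 alpha_ltn lfin elam mB lB.
set lamK : meas R n := mrestr lam (compact_measurableBRn cK) in fpot.
have mK := compact_measurableBRn cK.
have KE x : K x -> A x /\ pot nu x < pot mu x by move=> /KB /BE.
have TK : test_measure A lamK.
  split.
  - by rewrite /lamK /= /mrestr setTI finite_measure_lty.
  - exists K; split => // [x /KE[]//|].
    by rewrite /lamK /= /mrestr setICl measure0.
  - by exists f.
  - by exists C => x; rewrite fpot lee_fin.
have mmu := measurable_pot alpha Mmu.1; have mnu := measurable_pot alpha Mnu.1.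
have [] := intP lamK TK; rewrite /lamK !ge0_integral_mrestr//; try by move=> x; exact: pot_ge0.
move=> mufin le_mn.
(* A strictly positive difference on [K]. Both integrals over [K] are finite, so the inequality
   between them forces the integral of [w] to vanish, hence [lam K = 0]. *)
pose w (x : BRn R n) := pot mu x - pot nu x.
have mw : measurable_fun (K : set (BRn R n)) w.
  by apply: emeasurable_funB; apply: measurable_funTS.
have nufin x : K x -> pot nu x \is a fin_num.
  by move=> /KE[_ nm]; rewrite ge0_fin_numE ?pot_ge0// (lt_le_trans nm)// leey.
have w0 x : K x -> 0 < w x by move=> Kx; rewrite /w sube_gt0; exact: (KE x Kx).2.
have nuK : \int[lam]_(x in K) pot nu x <= \int[lam]_(x in K) pot mu x.
  apply: ge0_le_integral => //.
  - by move=> x _; exact: pot_ge0.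
  - exact: measurable_funTS.
  - exact: measurable_funTS.
  - by move=> x /KE[_ /ltW].
have wsum : \int[lam]_(x in K) pot mu x = \int[lam]_(x in K) pot nu x + \int[lam]_(x in K) w x.
  rewrite -ge0_integralD//.
  - by apply: eq_integral => x /set_mem Kx; rewrite /w addeC subeK// nufin.
  - by move=> x _; exact: pot_ge0.
  - exact: measurable_funTS.
  - by move=> x /w0/ltW.
have nuKfin : \int[lam]_(x in K) pot nu x \is a fin_num.
  rewrite ge0_fin_numE; first exact: le_lt_trans mufin.
  by apply: integral_ge0 => x _; exact: pot_ge0.
have wint0 : \int[lam]_(x in K) `|w x| = 0.
  rewrite (eq_integral w); last by move=> x /set_mem Kx; rewrite gee0_abs// ltW// w0.
  apply/eqP; rewrite eq_le; apply/andP; split.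
    by move: le_mn; rewrite wsum -[X in _ <= X]adde0 leeD2lE.
  by apply: integral_ge0 => x /w0/ltW.
have /ae_eq_integral_abs := wint0 => /(_ mK mw)[M [mM M0 KM]].
have : lam K = 0.
  apply: (subset_measure0 mK mM _ M0) => x Kx; apply: KM => /= /(_ Kx).
  by move=> wx; have := w0 x Kx; rewrite wx ltxx.
by move=> lK0; rewrite lK0 ltxx in lK.
Qed.

End TestMeasures.

(** * Equality of the balayages and of the sets of regular points *)

Theorem mainTheorem17 (R : realType) (n : nat) (alpha : R) :
  (3 <= n)%N -> 0 < alpha <= 2 ->
  forall A : set 'rV[R]_n,
  exists A0 : set 'rV[R]_n,
    [/\ A0 `<=` A,
        (exists K : nat -> set 'rV[R]_n,
           (forall k, compact (K k)) /\ A0 = \bigcup_k K k),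
        (forall mu : meas R n, Mplus alpha mu ->
           forall nu : meas R n,
             is_balayage alpha mu A nu <-> is_balayage alpha mu A0 nu)
      & (forall y : 'rV[R]_n, regular_pt alpha A y <-> regular_pt alpha A0 y)].
Proof.
move=> n3 /andP[_ alpha2] A.
have n_gt0 : (0 < n)%N by exact: ltn_trans n3.
have alpha_ltn : alpha < n%:R by rewrite (le_lt_trans alpha2)// ltr_nat.
have [A0 [A0A A0K A0P]] := ne_on_sigma_compact_core n_gt0 alpha_ltn A.
have balE (mu nu : meas R n) : Mplus alpha mu ->
    is_balayage alpha mu A nu <-> is_balayage alpha mu A0 nu.
  move=> Mmu; rewrite /is_balayage.
  have famE x : [set e | exists nu' : meas R n, [/\ Mplus alpha nu',
        ne_on alpha A (fun y => pot alpha mu y <= pot alpha nu' y)%E & e = pot alpha nu' x]] =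
      [set e | exists nu' : meas R n, [/\ Mplus alpha nu',
        ne_on alpha A0 (fun y => pot alpha mu y <= pot alpha nu' y)%E & e = pot alpha nu' x]].
    apply/seteqP; split => e [nu' [Mnu' ne ->]]; exists nu'; split => //.
      by apply/(A0P _ _ Mmu Mnu').
    by apply/(A0P _ _ Mmu Mnu').
  by split=> -[Mnu nuE]; split => // x; rewrite nuE famE.
exists A0; split => // [mu Mmu nu|y]; first exact: balE.
(* Regularity is the case where [mu] and [nu] are both the Dirac measure at [y]. Its membership in
   [Mplus] is read off from the hypothesis, a balayage being in [Mplus] by definition. *)
by split => ry; apply/(balE _ _ ry.1).
Qed.
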